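(* Let $G$ be a finite connected simple graph with $q$ edges, and let $1\le j\le q$. Then the graphicahedron $\mathcal{P}_G$ is $j$-face transitive if and only if $G$ is $j$-subgraph transitive.
   Context: Graphicahedron: let $G$ have vertex set $V(G)=\{1,\ldots,p\}$ and edge set $E(G)$ of size $q$. For an edge $e=\{i,j\}$ let $\tau_e=(i\;j)\in S_p$, and for $K\subseteq E(G)$ let $T_K=\langle\tau_e\mid e\in K\rangle\le S_p$. The faces of rank $i$ ($i$-faces, $0\le i\le q$) of the graphicahedron $\mathcal{P}_G$ are the equivalence classes of pairs $(K,\alpha)$ with $K\subseteq E(G)$, $|K|=i$, $\alpha\in S_p$, where $(K,\alpha)\sim(L,\beta)$ iff $K=L$ and $T_K\alpha=T_L\beta$ (right cosets). The order is $(K,\alpha)\le(L,\beta)$ iff $K\subseteq L$ and $T_K\alpha\subseteq T_L\beta$. A smallest face of rank $-1$ is appended. $\mathcal{P}_G$ is an abstract polytope of rank $q$. $\Gamma(\mathcal{P}_G)$ denotes the automorphism group of the poset $\mathcal{P}_G$. It is known that for $q\ne1$ one has $\Gamma(\mathcal{P}_G)=S_p\ltimes\Gamma(G)$, where $\Gamma(G)$ is the graph automorphism group of $G$, with $\gamma\in S_p$ acting by $(K,\alpha)\mapsto(K,\alpha\gamma^{-1})$ and $\kappa\in\Gamma(G)$ acting by $(K,\alpha)\mapsto(\kappa(K),\kappa\alpha\kappa^{-1})$. $\mathcal{P}_G$ is $j$-face transitive if $\Gamma(\mathcal{P}_G)$ acts transitively on the $j$-faces of $\mathcal{P}_G$.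 $G$ is $j$-subgraph transitive if for all $K,L\subseteq E(G)$ with $|K|=j=|L|$ there is a graph automorphism $\kappa$ of $G$ with $\kappa(K)=L$. *)

(* Defs.v *)
From HB Require Import structures.
From mathcomp Require Import all_boot all_order all_fingroup.

Set Implicit Arguments.
Unset Strict Implicit.
Unset Printing Implicit Defensive.

Import GroupScope.
Local Open Scope quotient_scope.

(* A simple graph on 'I_p is given by its edge set E, a set of 2-subsets of
   'I_p; its order is p and its size q is #|E|. *)
Definition simple_graph (p : nat) (E : {set {set 'I_p}}) : Prop :=
  forall e, e \in E -> #|e| = 2.

Definition adjacent (p : nat) (E : {set {set 'I_p}}) : rel 'I_p :=
  fun i j => [set i; j] \in E.

Definition connected_graph (p : nat) (E : {set {set 'I_p}}) : Prop :=
  forall i j, connect (adjacent E) i j.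

Definition graph_aut (p : nat) (E : {set {set 'I_p}}) : {set 'S_p} :=
  [set k : 'S_p | [forall i, forall j,
                     adjacent E (k i) (k j) == adjacent E i j]].

Lemma graph_aut_group_set (p : nat) (E : {set {set 'I_p}}) :
  group_set (graph_aut E).
Proof.
apply/group_setP; split=> [|k l].
  by rewrite inE; apply/'forall_'forall_eqP => i j; rewrite !perm1.
rewrite !inE => /'forall_'forall_eqP hk /'forall_'forall_eqP hl.
by apply/'forall_'forall_eqP => i j; rewrite !permM hl hk.
Qed.

Canonical graph_aut_group (p : nat) (E : {set {set 'I_p}}) :=
  Group (graph_aut_group_set E).

Definition subgraph_transitive (p : nat) (E : {set {set 'I_p}}) (j : nat) :
    Prop :=
  forall K L : {set {set 'I_p}}, K \subset E -> L \subset E ->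
    #|K| = j -> #|L| = j ->
    exists2 k : 'S_p, k \in graph_aut E & [set k @: (e : {set 'I_p}) | e in K] = L.

(* The subgroup T_K generated by the transpositions (i j) with {i, j} in K. *)
Definition transp_group (p : nat) (K : {set {set 'I_p}}) : {group 'S_p} :=
  <<[set tperm ij.1 ij.2 | ij : 'I_p * 'I_p & [set ij.1; ij.2] \in K]>>%G.

(* The right coset T_K alpha.  MathComp multiplies permutations from left to
   right; with the opposite convention one gets an isomorphic poset, through
   alpha |-> alpha^-1. *)
Definition transp_coset (p : nat) (x : {set {set 'I_p}} * 'S_p) : {set 'S_p} :=
  transp_group x.1 :* x.2.

Definition preface (p : nat) (E : {set {set 'I_p}}) :=
  {x : {set {set 'I_p}} * 'S_p | x.1 \subset E}.

Definition preface_equiv (p : nat) (E : {set {set 'I_p}}) : rel (preface E) :=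
  fun x y => ((val x).1 == (val y).1)
          && (transp_coset (val x) == transp_coset (val y)).

Definition preface_le (p : nat) (E : {set {set 'I_p}}) : rel (preface E) :=
  fun x y => ((val x).1 \subset (val y).1)
          && (transp_coset (val x) \subset transp_coset (val y)).

Lemma preface_equiv_is_equiv (p : nat) (E : {set {set 'I_p}}) :
  equiv_class_of (@preface_equiv p E).
Proof.
split=> [x | x y | y x z]; rewrite /preface_equiv.
- by rewrite !eqxx.
- by rewrite eq_sym [X in _ && X]eq_sym.
- by move=> /andP[/eqP-> /eqP->].
Qed.

Canonical preface_equiv_rel (p : nat) (E : {set {set 'I_p}}) :=
  EquivRelPack (preface_equiv_is_equiv E).

Definition face (p : nat) (E : {set {set 'I_p}}) :=
  {eq_quot preface_equiv_rel E}.

HB.instance Definition _ (p : nat) (E : {set {set 'I_p}}) :=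
  Quotient.on (face E).
HB.instance Definition _ (p : nat) (E : {set {set 'I_p}}) :=
  [Finite of face E by <:%/].

Definition face_edges (p : nat) (E : {set {set 'I_p}}) (F : face E) :
    {set {set 'I_p}} :=
  (val (generic_quotient.repr F)).1.

Definition face_le (p : nat) (E : {set {set 'I_p}}) : rel (face E) :=
  fun F H => preface_le (generic_quotient.repr F) (generic_quotient.repr H).

Lemma repr_face (p : nat) (E : {set {set 'I_p}}) (x : preface E) :
  (val (generic_quotient.repr (\pi_(face E) x))).1 = (val x).1 /\
  transp_coset (val (generic_quotient.repr (\pi_(face E) x))) = transp_coset (val x).
Proof.
have /eqmodP /= : generic_quotient.repr (\pi_(face E) x) = x %[mod face E] by rewrite reprK.
by case/andP=> /eqP-> /eqP->.
Qed.

Lemma face_edges_pi (p : nat) (E : {set {set 'I_p}}) (x : preface E) :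
  face_edges (\pi_(face E) x) = (val x).1.
Proof. by have [] := repr_face x. Qed.

Lemma face_le_pi (p : nat) (E : {set {set 'I_p}}) (x y : preface E) :
  face_le (\pi_(face E) x) (\pi_(face E) y) = preface_le x y.
Proof.
rewrite /face_le /preface_le.
by have [-> ->] := repr_face x; have [-> ->] := repr_face y.
Qed.

(* None is the face of rank -1. *)
Definition graphicahedron (p : nat) (E : {set {set 'I_p}}) : Type :=
  option (face E).

HB.instance Definition _ (p : nat) (E : {set {set 'I_p}}) :=
  Finite.on (graphicahedron E).

Definition graphicahedron_le (p : nat) (E : {set {set 'I_p}}) :
    rel (graphicahedron E) :=
  fun x y => match x, y with
             | None, _ => true
             | Some _, None => false
             | Some F, Some H => face_le F H
             end.

Lemma graphicahedron_le_refl (p : nat) (E : {set {set 'I_p}}) :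
  reflexive (@graphicahedron_le p E).
Proof. by case=> //= F; rewrite /face_le /preface_le !subxx. Qed.

Lemma graphicahedron_le_anti (p : nat) (E : {set {set 'I_p}}) :
  antisymmetric (@graphicahedron_le p E).
Proof.
case=> [F|] [H|] //= /andP[/andP[s1 c1] /andP[s2 c2]].
congr Some; rewrite -[F]reprK -[H]reprK; apply/eqmodP => /=.
by rewrite /preface_equiv !eqEsubset s1 s2 c1 c2.
Qed.

Lemma graphicahedron_le_trans (p : nat) (E : {set {set 'I_p}}) :
  transitive (@graphicahedron_le p E).
Proof.
case=> [H|] [F|] [M|] //= /andP[s1 c1] /andP[s2 c2].
by apply/andP; split; [apply: subset_trans s2 | apply: subset_trans c2].
Qed.

Fact graphicahedron_display : Order.disp_t.
Proof. exact: Order.Disp tt tt. Qed.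

HB.instance Definition _ (p : nat) (E : {set {set 'I_p}}) :=
  @Order.Le_isPOrder.Build graphicahedron_display (graphicahedron E)
    (@graphicahedron_le p E) (@graphicahedron_le_refl p E)
    (@graphicahedron_le_anti p E) (@graphicahedron_le_trans p E).

Definition poset_aut (d : Order.disp_t) (P : finPOrderType d) : {set {perm P}} :=
  [set f : {perm P} | [forall x, forall y, (f x <= f y)%O == (x <= y)%O]].

Lemma poset_aut_group_set (d : Order.disp_t) (P : finPOrderType d) :
  group_set (poset_aut P).
Proof.
apply/group_setP; split=> [|f g].
  by rewrite inE; apply/'forall_'forall_eqP => x y; rewrite !perm1.
rewrite !inE => /'forall_'forall_eqP hf /'forall_'forall_eqP hg.
by apply/'forall_'forall_eqP => x y; rewrite !permM hg hf.
Qed.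

Canonical poset_aut_group (d : Order.disp_t) (P : finPOrderType d) :=
  Group (poset_aut_group_set P).

Definition rank_faces (p : nat) (E : {set {set 'I_p}}) (j : nat) :
    {set graphicahedron E} :=
  [set x | if x is Some F then #|face_edges F| == j else false].

Definition face_transitive (p : nat) (E : {set {set 'I_p}}) (j : nat) : Prop :=
  [transitive poset_aut (graphicahedron E), on rank_faces E j | 'P].

(* Main.v *)
Require Import Defs.
From mathcomp Require Import all_boot all_order all_fingroup cyclic.

Set Implicit Arguments.
Unset Strict Implicit.
Unset Printing Implicit Defensive.

Import GroupScope.
Local Open Scope quotient_scope.

(** A permutation of the vertices of G that respects adjacency, followed by a
    right translation of S_p, acts on the graphicahedron.  Right translations
    are transitive on the cosets belonging to one edge set, so subgraph
    transitivity gives face transitivity at once ([graph_aut_poset_aut]).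

    Conversely let an automorphism f of the graphicahedron send the face
    (K, 1) to the face (L, 1).  Writing 0 for the empty edge set, it
    sends the vertex (0, 1) to some vertex (0, b).  The faces above a given vertex form a copy of the lattice of
    subsets of E, and an embedding of that finite lattice into itself is
    induced by an injection of E ([powerset_embedding]); so there is an
    injection phi : E -> E with f (M, 1) = (phi(M), b) for all M, and in
    particular phi(K) = L ([poset_aut_edge_map]).

    It remains to see that phi comes from a vertex permutation.  This is a
    form of Whitney's theorem on line graphs, whose exceptional cases all come
    from the fact that a line graph does not distinguish a triangle from the
    star with three edges.  The graphicahedron does: f preserves the number of
    vertices below a face, and the face (M, a) lies above #|T_M| of them, so
    phi preserves the order of T_M for every M.  Two distinct edges meet iff
    their transpositions generate a group of order greater than 4
    ([card_transp_group_pair]), and three pairwise meeting edges e, f, g have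
    a common vertex iff adding the transposition of g enlarges T_{e,f}
    ([card_transp_group_triple]).  Hence, once two edges e and f at v are
    fixed, the set of edges at v is described by orders of groups T_M
    ([mem_edge_star]), and phi maps it to the set of edges at some vertex,
    which is taken as the image of v ([edge_map_induced]). *)

(** * Embeddings of a powerset into itself *)

(** An embedding preserves strict inclusion.  A maximal chain from the empty
    set to M thus gives #|M| <= #|Phi M|, and one from M to E gives the
    converse.  So Phi preserves cardinality and sends singletons to singletons,
    which defines phi. *)
Lemma powerset_embedding (T : finType) (E : {set T}) (Phi : {set T} -> {set T}) :
    (forall M : {set T}, M \subset E -> Phi M \subset E) ->
    {in powerset E &, forall M N, (Phi M \subset Phi N) = (M \subset N)} ->
  exists phi : T -> T,
    [/\ {in E, forall e, phi e \in E}, {in E &, injective phi}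
      & forall M : {set T}, M \subset E -> Phi M = phi @: M].
Proof.
move=> sPhi Phi_le.
have Phi_lt (M N : {set T}) : M \proper N -> N \subset E -> #|Phi M| < #|Phi N|.
  move=> /properP[sMN [x xN xM]] sNE; apply: proper_card.
  rewrite properEneq !Phi_le ?inE ?sMN ?(subset_trans sMN) // andbT.
  apply: contraNneq xM => eqP; rewrite (subsetP _ x xN) // -Phi_le ?eqP //.
    by rewrite inE.
  by rewrite inE (subset_trans sMN).
have ge_card n (M : {set T}) : #|M| = n -> M \subset E -> n <= #|Phi M|.
  elim: n M => // n IHn M cM sME.
  have /card_gt0P[x xM]: 0 < #|M| by rewrite cM.
  apply: leq_ltn_trans (Phi_lt (M :\ x) M (properD1 xM) sME).
  apply: IHn (subset_trans (subsetDl _ _) sME).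
  by apply/eqP; rewrite -eqSS -cM (cardsD1 x M) xM.
have le_card n (M : {set T}) : #|E :\: M| = n -> M \subset E -> #|Phi M| <= #|M|.
  elim: n M => [|n IHn] M cM sME.
    have <-: E = M by apply/eqP; rewrite eqEsubset sME -setD_eq0 -cards_eq0 cM eqxx.
    exact: subset_leq_card (sPhi _ _).
  have /card_gt0P[x /setDP[xE xM]]: 0 < #|E :\: M| by rewrite cM.
  have sxE: x |: M \subset E by rewrite subUset sub1set xE.
  have ltM: M \proper x |: M.
    by apply/properP; split; [exact: subsetUr | exists x; rewrite // setU11].
  rewrite -ltnS; apply: leq_trans (Phi_lt _ _ ltM sxE) _.
  have <-: #|x |: M| = #|M|.+1 by rewrite cardsU1 xM.
  apply: (IHn _ _ sxE).
  apply/eqP; rewrite -eqSS -cM (cardsD1 x (E :\: M)) inE xM xE add1n eqSS.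
  by apply/eqP; congr #|pred_of_set _|; apply/setP => y; rewrite !inE negb_or andbA.
have cardPhi (M : {set T}) : M \subset E -> #|Phi M| = #|M|.
  by move=> sME; apply/eqP; rewrite eqn_leq (le_card _ M erefl) ?(ge_card _ M erefl).
pose phi e := odflt e [pick d in Phi [set e]].
have phiE e : e \in E -> Phi [set e] = [set phi e].
  move=> eE; have /eqP/cards1P[d Pd]: #|Phi [set e]| = 1%N.
    by rewrite cardPhi ?cards1 ?sub1set.
  rewrite /phi Pd; case: pickP => [x|/(_ d)]; rewrite !inE ?eqxx //.
  by move/eqP->.
have phi_inj : {in E &, injective phi}.
  move=> d e dE eE eq_de; apply/set1P.
  by rewrite -sub1set -Phi_le ?inE ?sub1set // !phiE // eq_de.
exists phi; split=> // [e eE | M sME].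
  by rewrite -sub1set -phiE // sPhi ?sub1set.
apply/esym/eqP; rewrite eqEcard cardPhi // card_in_imset ?leqnn ?andbT; last first.
  exact: sub_in2 (subsetP sME) _ phi_inj.
apply/subsetP => _ /imsetP[e eM ->]; have eE := subsetP sME e eM.
by rewrite -sub1set -phiE // Phi_le ?inE ?sub1set.
Qed.

(** * Groups generated by the transpositions of a set of edges *)

Section TranspGroup.
Variable p : nat.
Implicit Types (K L : {set {set 'I_p}}) (u v x y : 'I_p).

Lemma mem_transp_group K x y : [set x; y] \in K -> tperm x y \in transp_group K.
Proof.
by move=> xyK; apply: mem_gen; apply/imsetP; exists (x, y); rewrite ?inE.
Qed.

Lemma transp_group_subset K (G : {group 'S_p}) :
    (forall x y, [set x; y] \in K -> tperm x y \in G) ->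
  transp_group K \subset G.
Proof.
move=> KG; rewrite gen_subG; apply/subsetP => s /imsetP[[x y] xyK ->].
by move: xyK; rewrite inE; apply: KG.
Qed.

Lemma transp_groupS K L : K \subset L -> transp_group K \subset transp_group L.
Proof.
move=> sKL; apply: transp_group_subset => x y /(subsetP sKL).
exact: mem_transp_group.
Qed.

Lemma transp_group0 : transp_group (set0 : {set {set 'I_p}}) = 1 :> {set 'S_p}.
Proof. by apply/trivgP; apply: transp_group_subset => x y; rewrite inE. Qed.

Lemma mem_imset_perm (k : 'S_p) K (e : {set 'I_p}) :
  (k @: e \in [set k @: (d : {set 'I_p}) | d in K]) = (e \in K).
Proof. by rewrite mem_imset //; apply: imset_inj; apply: perm_inj. Qed.

Lemma transp_groupJ K (k : 'S_p) :
  transp_group [set k @: (e : {set 'I_p}) | e in K] = transp_group K :^ k :> {set _}.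
Proof.
rewrite /transp_group /= -genJ; congr <<_>>; apply/setP => s.
rewrite mem_conjg; apply/imsetP/imsetP => -[[x y]]; rewrite inE /= => xyK sE.
  exists (k^-1 x, k^-1 y); rewrite ?inE /= ?sE ?tpermJ //.
  by rewrite -(mem_imset_perm k) imsetU !imset_set1 !permKV.
exists (k x, k y); rewrite ?inE /=; last by rewrite -tpermJ -sE conjgKV.
have := mem_imset_perm k K [set x; y].
by rewrite imsetU !imset_set1 xyK.
Qed.

Lemma edge_ext (e g : {set 'I_p}) x y : #|e| = 2 -> #|g| = 2 -> x != y ->
  x \in e -> y \in e -> x \in g -> y \in g -> e = g.
Proof.
move=> ce cg xy xe ye xg yg.
have E2 (h : {set 'I_p}) : #|h| = 2 -> x \in h -> y \in h -> h = [set x; y].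
  move=> ch xh yh; apply/esym/eqP; rewrite eqEcard subUset !sub1set xh yh.
  by rewrite ch cards2 xy.
by rewrite (E2 e ce xe ye) (E2 g cg xg yg).
Qed.

Lemma edgeP (e : {set 'I_p}) x : #|e| = 2 -> x \in e ->
  exists2 y, x != y & e = [set x; y].
Proof.
move=> /eqP/cards2P[a [b [ab ->]]] /set2P[]->.
  by exists b.
by exists a; rewrite 1?eq_sym // setUC.
Qed.

Lemma transp_group_pair (a b c d : 'I_p) :
  transp_group [set [set a; b]; [set c; d]] = <<[set tperm a b; tperm c d]>> :> {set _}.
Proof.
apply/eqP; rewrite eqEsubset; apply/andP; split; last first.
  by rewrite gen_subG subUset !sub1set !mem_transp_group // !inE eqxx ?orbT.
apply: (transp_group_subset (G := <<_>>%G)) => x y.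
have E2 (u v : 'I_p) : [set x; y] = [set u; v] -> tperm x y = tperm u v.
  move=> E; have : x \in [set u; v] by rewrite -E set21.
  have : y \in [set u; v] by rewrite -E set22.
  have : u \in [set x; y] by rewrite E set21.
  have : v \in [set x; y] by rewrite E set22.
  rewrite !inE => Hv Hu /orP[]/eqP ?  /orP[]/eqP ?; subst => //.
  - by move: Hv; rewrite orbb => /eqP->.
  - by rewrite tpermC.
  - by move: Hu; rewrite orbb => /eqP->.
by case/set2P => /E2->; apply: mem_gen; rewrite ?set21 ?set22.
Qed.

Lemma order_tperm_dvd x y : #[tperm x y] %| 2.
Proof. by rewrite order_dvdn expgS expg1 tperm2. Qed.

(** Disjoint transpositions commute and generate a group of order at most 4;
    if the edges share exactly one vertex, the product of the transpositions
    is a 3-cycle, and both 2 and 3 divide the order. *)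
Lemma card_transp_group_pair (e g : {set 'I_p}) :
    #|e| = 2 -> #|g| = 2 -> e != g ->
  (4 < #|transp_group [set e; g]|) = ~~ [disjoint e & g].
Proof.
move=> ce cg eg; case: (boolP [disjoint e & g]) => [dis|].
  apply/negbTE; rewrite -leqNgt.
  move/eqP/cards2P: ce => [a [b [ab eE]]]; move/eqP/cards2P: cg => [c [d [cd gE]]].
  rewrite eE gE transp_group_pair.
  have -> : <<[set tperm a b; tperm c d]>> = <[tperm a b]> <*> <[tperm c d]>.
    by rewrite joing_idl joing_idr.
  rewrite cent_joinEl; last first.
    rewrite cent_cycle cycle_subG; apply/cent1P.
    have dis' u v : u \in e -> v \in g -> u != v.
      by move=> ue; apply: contraTneq => <-; rewrite (disjointFr dis ue).
    apply/commgP/conjg_fixP; rewrite tpermJ.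
    by rewrite !tpermD // eq_sym dis' ?eE ?gE ?set21 ?set22.
  apply: leq_trans (_ : #|<[tperm a b]>| * #|<[tperm c d]>| <= 4).
    by rewrite mul_cardG leq_pmulr // cardG_gt0.
  by rewrite (@leq_mul _ _ 2 2) // dvdn_leq // order_tperm_dvd.
case/pred0Pn=> v /= /andP[ve vg].
have [a va eE] := edgeP ce ve; have [b vb gE] := edgeP cg vg.
have ab : a != b by apply: contraNneq eg => E; rewrite eE gE E.
rewrite eE gE transp_group_pair; set T := <<_>>.
have [xT yT]: tperm v a \in T /\ tperm v b \in T.
  by split; rewrite mem_gen ?set21 ?set22.
have o2 : #[tperm v a] = 2.
  apply/prime_nt_dvdP; rewrite ?order_tperm_dvd // order_eq1.
  by apply: contraNneq va => /permP/(_ v); rewrite tpermL perm1 => ->.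
have braid : tperm v a * tperm v b * tperm v a = tperm v b * tperm v a * tperm v b.
  have -> : tperm v a * tperm v b * tperm v a = tperm v b ^ tperm v a.
    by rewrite /conjg tpermV mulgA.
  have -> : tperm v b * tperm v a * tperm v b = tperm v a ^ tperm v b.
    by rewrite /conjg tpermV mulgA.
  by rewrite !tpermJ !tpermL !tpermD // 1?eq_sym // tpermC.
have o3 : #[tperm v a * tperm v b] = 3.
  apply/prime_nt_dvdP => //; last first.
    (* (x y)^3 = (x y x) (y x y) is the square of x y x *)
    rewrite order_dvdn !expgS expg0 mulg1 !mulgA braid -!mulgA.
    rewrite [X in _ * (_ * X)]mulgA tperm2 mul1g.
    by rewrite [X in _ * X]mulgA tperm2 mul1g tperm2.
  rewrite order_eq1; apply: contraNneq (va) => /permP/(_ v).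
  by rewrite permM tpermL perm1 (tpermD va) 1?eq_sym // => ->.
apply: (@leq_trans 6) => //; apply: dvdn_leq; first exact: cardG_gt0.
rewrite (@Gauss_dvd 2 3) // -{1}o2 -o3; apply/andP; split; apply: order_dvdG => //.
exact: groupM.
Qed.

(** Here v is common to e and f.  If g avoids v then e, f, g form a triangle,
    and the transposition of g is conjugate to that of e under that of f.
    If g = {v, c}, the point c moved by the transposition of g is fixed by all
    of T_{e,f}. *)
Lemma card_transp_group_triple (e f g : {set 'I_p}) v :
    #|e| = 2 -> #|f| = 2 -> #|g| = 2 -> e != f -> g != e -> g != f ->
    v \in e -> v \in f -> ~~ [disjoint e & g] -> ~~ [disjoint f & g] ->
  (#|transp_group [set e; f]| < #|transp_group [set e; f; g]|) = (v \in g).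
Proof.
move=> ce cf cg ef ge gf ve vf eg fg.
have [a va eE] := edgeP ce ve; have [b vb fE] := edgeP cf vf.
have sT : transp_group [set e; f] \subset transp_group [set e; f; g].
  by apply/transp_groupS/subsetUl.
have ab : a != b by apply: contraNneq ef => E; rewrite eE fE E.
case: (boolP (v \in g)) => [vg | vNg].
  have [c vc gE] := edgeP cg vg.
  have ac : a != c by apply: contraNneq ge => E; rewrite eE gE E.
  have bc : b != c by apply: contraNneq gf => E; rewrite fE gE E.
  have vcT : tperm v c \in transp_group [set e; f; g].
    by rewrite mem_transp_group // -gE !inE eqxx orbT.
  apply: proper_card; apply/properP; split; first exact: sT.
  exists (tperm v c) => //; apply: contra (vc) => vcT'.
  have /subsetP/(_ _ vcT') : transp_group [set e; f] \subset 'C[c | 'P].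
    rewrite eE fE transp_group_pair gen_subG subUset !sub1set !inE !sub1set !inE /=.
    by rewrite /aperm !tpermD ?eqxx.
  by move/astab1P; rewrite /= /aperm tpermR => ->.
have mem_g h d : h = [set v; d] -> ~~ [disjoint h & g] -> d \in g.
  move=> -> /pred0Pn[x /= /andP[/set2P[]-> //]].
  by rewrite (negPf vNg).
have ag := mem_g e a eE eg; have bg := mem_g f b fE fg.
have gE : g = [set a; b].
  by apply: (edge_ext cg _ ab); rewrite ?set21 ?set22 // cards2 ab.
apply/negbTE; rewrite -leqNgt; apply: subset_leq_card.
have T2 : transp_group [set e; f] = <<[set tperm v a; tperm v b]>> :> {set _}.
  by rewrite eE fE transp_group_pair.
have aT : tperm v a \in transp_group [set e; f] by rewrite T2 mem_gen // set21.
have bT : tperm v b \in transp_group [set e; f] by rewrite T2 mem_gen // set22.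
have abT : tperm a b \in transp_group [set e; f].
  have -> : tperm a b = tperm v a ^ tperm v b.
    by rewrite tpermJ tpermL tpermD // 1?eq_sym // tpermC.
  exact: groupJ.
have g2 : transp_group [set g] \subset transp_group [set e; f].
  rewrite -[[set g]]setUid gE; rewrite transp_group_pair.
  by rewrite gen_subG subUset sub1set abT.
apply: transp_group_subset => x y; rewrite in_setU => /orP[|xyg].
  exact: mem_transp_group.
exact: subsetP g2 _ (mem_transp_group xyg).
Qed.

(** The right-hand side mentions only equality of edges and orders of groups
    T_M, hence it is invariant under an injection of edges preserving these
    orders. *)
Lemma mem_edge_star (e f g : {set 'I_p}) v :
    #|e| = 2 -> #|f| = 2 -> #|g| = 2 -> e != f -> v \in e -> v \in f ->
  (v \in g) = [|| g == e, g == f |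
    [&& 4 < #|transp_group [set e; g]|, 4 < #|transp_group [set f; g]| &
        #|transp_group [set e; f]| < #|transp_group [set e; f; g]|]].
Proof.
move=> ce cf cg ef ve vf.
have [->|ge] := eqVneq g e; first by [].
have [->|gf] := eqVneq g f; first by [].
rewrite /= !card_transp_group_pair // 1?eq_sym //.
have [eg|eg] /= := boolP [disjoint e & g].
  by apply: contraTF ve => vg; rewrite (disjointFl eg).
have [fg|fg] /= := boolP [disjoint f & g].
  by apply: contraTF vf => vg; rewrite (disjointFl fg).
by rewrite (@card_transp_group_triple e f g v).
Qed.
End TranspGroup.

(** * Edge maps induced by graph automorphisms *)

Section EdgeMap.
Variables (p : nat) (E : {set {set 'I_p}}).
Hypotheses (simpleE : simple_graph E) (connE : connected_graph E).

Lemma lone_edge e : e \in E ->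
  (forall g, g \in E -> ~~ [disjoint e & g] -> g = e) -> #|E| <= 1.
Proof.
move=> eE lone; have ce := simpleE eE.
have stab x y : adjacent E x y -> x \in e -> y \in e.
  move=> xyE xe; rewrite -(lone _ xyE) ?set22 //.
  by apply/pred0Pn; exists x; rewrite /= xe set21.
have all_e x : x \in e.
  have /card_gt0P[v ve] : 0 < #|e| by rewrite ce.
  have /connectP[s path_s ->] := connE v x.
  by elim: s v ve path_s => //= y s IHs v ve /andP[/stab/(_ ve) ye]; apply: IHs.
rewrite -(cards1 e); apply: subset_leq_card; apply/subsetP => g gE.
rewrite inE; apply/eqP; apply: lone => //.
have /card_gt0P[v vg] : 0 < #|g| by rewrite simpleE.
by apply/pred0Pn; exists v; rewrite /= all_e.
Qed.

Lemma vertex_edge v : 0 < #|E| -> exists2 e, e \in E & v \in e.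
Proof.
case/card_gt0P => e eE; have /card_gt0P[x xe] : 0 < #|e| by rewrite simpleE.
have [vx | vx] := eqVneq v x; first by exists e; rewrite ?vx.
have /connectP[[|y s] /= path_s xl] := connE v x; first by rewrite xl eqxx in vx.
by case/andP: path_s => vyE _; exists [set v; y]; rewrite ?set21.
Qed.

(** The image of v is the vertex w whose edges are the images of the edges
    at v.  Any two edges at v determine w.  If v is a leaf on the edge
    e = {v, u} and e is not the whole graph, then u has at least two edges and
    thus an image, and w is the other end of [phi e].  With at least two edges,
    distinct vertices have distinct sets of edges, so this map is injective. *)
Lemma edge_map_induced (phi : {set 'I_p} -> {set 'I_p}) :
    {in E, forall e, phi e \in E} -> {in E &, injective phi} ->
    (forall M : {set {set 'I_p}}, M \subset E ->
       #|transp_group (phi @: M)| = #|transp_group M|) ->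
  exists2 k : 'S_p, k \in graph_aut E &
    (forall e : {set 'I_p}, e \in E -> k @: e = phi e).
Proof.
move=> phiE phi_inj phi_card.
have [E1|E2] := leqP #|E| 1.
  (* phi is the identity of a set with at most one element *)
  exists 1 => [|e eE]; first exact: group1.
  rewrite (eq_imset _ (@perm1 _)) imset_id.
  by apply: (card_le1_eqP E1); rewrite ?phiE.
have phi_meet e g : e \in E -> g \in E -> e != g ->
    [disjoint phi e & phi g] = [disjoint e & g].
  move=> eE gE eg; apply: negb_inj.
  rewrite -!card_transp_group_pair ?simpleE ?phiE ?(inj_in_eq phi_inj) //.
  by rewrite -(phi_card [set e; g]) ?imsetU ?imset_set1 // subUset !sub1set eE.
pose image_vertex v w := forall g, g \in E -> (v \in g) = (w \in phi g).
have image2 v e f : e \in E -> f \in E -> e != f -> v \in e -> v \in f ->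
    exists w, image_vertex v w.
  move=> eE fE ef ve vf.
  have /pred0Pn[w /= /andP[we wf]] : ~~ [disjoint phi e & phi f].
    by rewrite phi_meet //; apply/pred0Pn; exists v; rewrite /= ve.
  have phi_ef : phi e != phi f by rewrite (inj_in_eq phi_inj).
  exists w => g gE; rewrite (mem_edge_star _ _ _ ef ve vf) ?simpleE //.
  rewrite (mem_edge_star _ _ _ phi_ef we wf) ?simpleE ?phiE //.
  rewrite !(inj_in_eq phi_inj) //.
  have subE (M : {set {set 'I_p}}) : {subset M <= [set e; f; g]} -> M \subset E.
    move=> sM; apply/subsetP => d /sM.
    by rewrite !inE -orbA => /or3P[]/eqP->.
  rewrite -(phi_card [set e; g]) -?(phi_card [set f; g])
          -?(phi_card [set e; f]) -?(phi_card [set e; f; g]) ?imsetU ?imset_set1 //;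
  by apply: subE => d; rewrite !inE => /orP[]->; rewrite ?orbT.
have imageP v : exists w, image_vertex v w.
  have [e eE ve] := vertex_edge v (ltnW E2).
  (* either a second edge f at v exists, or v is a leaf *)
  case: (pickP [pred f in E | (f != e) && (v \in f)]) => [f|leaf].
    by case/and3P=> fE fe vf; apply: (image2 v f e).
  have [u vu def_e] := edgeP (simpleE eE) ve.
  have [f /and3P[fE fe ef]] : exists f, [&& f \in E, f != e & ~~ [disjoint e & f]].
    apply/existsP; apply: contraLR (E2) => /existsPn none; rewrite -leqNgt.
    apply: (lone_edge eE) => g gE eg; apply/eqP; apply: contraTT eg => ge.
    by have := none g; rewrite gE ge.
  have only_e g : g \in E -> v \in g -> g = e.
    move=> gE vg; apply/eqP; apply: contraFT (leaf g) => ge.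
    by rewrite !inE gE ge.
  have meet_u g : g \in E -> g != e -> ~~ [disjoint e & g] -> u \in g.
    move=> gE ge /pred0Pn[x /= /andP[]]; rewrite def_e => /set2P[]-> // vg.
    by rewrite (only_e g) ?eqxx in ge.
  have uf := meet_u f fE fe ef.
  have [|w w_u] := image2 u f e fE eE fe uf; first by rewrite def_e set22.
  have we : w \in phi e by rewrite -w_u // def_e set22.
  have [w' ww' def_phie] := edgeP (simpleE (phiE e eE)) we.
  have w'e : w' \in phi e by rewrite def_phie set22.
  exists w' => g gE; have [->|ge] := eqVneq g e; first by rewrite ve w'e.
  have -> : (v \in g) = false.
    by apply: contraNF ge => vg; rewrite (only_e g).
  apply/esym/negP => w'g.
  have wg : w \in phi g.
    rewrite -w_u //; apply: meet_u => //; rewrite -phi_meet // 1?eq_sym //.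
    by apply/pred0Pn; exists w'; rewrite /= w'e.
  case/eqP: ge; apply: phi_inj => //.
  by apply: (edge_ext _ _ ww'); rewrite ?simpleE ?phiE.
pose k v := odflt v [pick w | [forall g in E, (v \in g) == (w \in phi g)]].
have kP v : image_vertex v (k v).
  rewrite /k; case: pickP => [w /'forall_in_eqP|none] //.
  have [w w_v] := imageP v; have /idP[] := none w.
  by apply/'forall_in_eqP.
have k_inj : injective k.
  move=> v v' kvv'; apply/eqP; apply: contraLR (E2) => vv'; rewrite -leqNgt.
  have [e eE ve] := vertex_edge v (ltnW E2).
  have twin g : g \in E -> (v \in g) = (v' \in g).
    by move=> gE; rewrite (kP v) // (kP v') // kvv'.
  apply: (lone_edge eE) => g gE /pred0Pn[x /= /andP[xe xg]].
  have def_e : e = [set v; v'].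
    by apply: (edge_ext _ _ vv'); rewrite ?cards2 ?vv' ?set21 ?set22 ?simpleE // -twin.
  have vg : v \in g by move: xe xg; rewrite def_e => /set2P[]->; rewrite // twin.
  by apply: (edge_ext _ _ vv'); rewrite ?simpleE // -twin.
have k_edge e : e \in E -> perm k_inj @: e = phi e.
  move=> eE; apply/eqP; rewrite eqEcard card_imset; last exact: perm_inj.
  rewrite !simpleE ?phiE // leqnn andbT; apply/subsetP => x /imsetP[v ve ->].
  by rewrite permE -(kP v).
exists (perm k_inj) => //.
have phi_onto d : d \in E -> exists2 e, e \in E & d = phi e.
  have phi_E : phi @: E = E.
    apply/eqP; rewrite eqEcard card_in_imset // leqnn andbT.
    by apply/subsetP => x /imsetP[e eE ->]; apply: phiE.
  by rewrite -{1}phi_E => /imsetP[e eE ->]; exists e.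
rewrite inE; apply/'forall_'forall_eqP => x y; rewrite /adjacent.
rewrite -!imset_set1 -imsetU; apply/idP/idP => [|xyE]; last by rewrite k_edge ?phiE.
case/phi_onto => e eE; rewrite -k_edge // => /imset_inj -> //.
exact: perm_inj.
Qed.
End EdgeMap.

(** * Faces and automorphisms of the graphicahedron *)

Section Faces.
Variables (p : nat) (E : {set {set 'I_p}}).
Implicit Types (K L M : {set {set 'I_p}}) (a b : 'S_p) (x y : graphicahedron E).
Implicit Types (f : {perm graphicahedron E}).

(** Intersecting with E makes the constructor total, so that no inclusion
    proof is carried around; it is only used for K included in E. *)
Definition face_of K a : graphicahedron E :=
  Some (\pi_(face E) (exist _ (K :&: E, a) (subsetIr K E) : preface E)).

Lemma face_of_le K L a b : K \subset E -> L \subset E ->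
  (face_of K a <= face_of L b)%O = (K \subset L) && (a * b^-1 \in transp_group L).
Proof.
move=> /setIidPl KE /setIidPl LE.
have -> : (face_of K a <= face_of L b)%O =
    (K \subset L) && (transp_coset (K, a) \subset transp_coset (L, b)).
  rewrite -[LHS]/(face_le _ _) face_le_pi /preface_le /=.
  by rewrite KE LE.
have [sKL|//] := boolP (K \subset L); rewrite /transp_coset /= -mem_rcoset.
apply/idP/idP => [/subsetP->//|aL]; first exact: rcoset_refl.
by rewrite -(rcoset_eqP aL) mulSg // transp_groupS.
Qed.

Lemma face_edges_face_of j K a : K \subset E ->
  (face_of K a \in rank_faces E j) = (#|K| == j).
Proof.
move=> /setIidPl KE; rewrite inE.
by rewrite -[LHS]/(#|face_edges (\pi_(face E) _)| == j) face_edges_pi /= KE.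
Qed.

Lemma face_edges_sub (F : face E) : face_edges F \subset E.
Proof. exact: valP (generic_quotient.repr F). Qed.

Definition face_perm (F : face E) : 'S_p := (val (generic_quotient.repr F)).2.

Lemma face_of_repr (F : face E) : Some F = face_of (face_edges F) (face_perm F).
Proof.
congr Some; rewrite -{1}[F]reprK; congr (\pi_(face E) _); apply: val_inj => /=.
by rewrite (setIidPl (face_edges_sub F)) -surjective_pairing.
Qed.

Lemma face_ofP x : x != None ->
  exists2 K : {set {set 'I_p}}, K \subset E & exists a, x = face_of K a.
Proof.
case: x => // F _; exists (face_edges F); first exact: face_edges_sub.
by exists (face_perm F); apply: face_of_repr.
Qed.

Lemma face_of_eq K a b : K \subset E -> a * b^-1 \in transp_group K ->
  face_of K a = face_of K b.
Proof.
move=> KE abK; apply/eqP; rewrite Order.POrderTheory.eq_le !face_of_le // subxx abK /=.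
by rewrite -[b * _]invgK invMg invgK groupV.
Qed.

Lemma face_of_inj K L a b : K \subset E -> L \subset E ->
  face_of K a = face_of L b -> K = L.
Proof.
move=> KE LE /eqP; rewrite Order.POrderTheory.eq_le !face_of_le //.
case/andP=> /andP[KL _] /andP[LK _].
by apply/eqP; rewrite eqEsubset KL.
Qed.

Lemma face_of_vertex_inj : injective (face_of set0).
Proof.
move=> a b /eqP; rewrite Order.POrderTheory.eq_le !face_of_le ?sub0set //=.
rewrite (transp_group0 p) => /andP[/set1P ab _].
by apply/eqP; rewrite eq_mulgV1 ab.
Qed.

Lemma poset_autP f :
  reflect {mono f : x y / (x <= y)%O} (f \in poset_aut (graphicahedron E)).
Proof. by rewrite inE; apply: 'forall_'forall_eqP. Qed.

Lemma poset_aut_None f : f \in poset_aut (graphicahedron E) -> f None = None.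
Proof.
move=> /poset_autP f_le; have := f_le None (f^-1 None).
by rewrite permKV [RHS]/=; case: (f None).
Qed.

Lemma poset_aut_face f K a : f \in poset_aut (graphicahedron E) ->
  exists2 L : {set {set 'I_p}}, L \subset E & exists b, f (face_of K a) = face_of L b.
Proof.
move=> fA; apply: face_ofP; rewrite -(poset_aut_None fA).
by rewrite (inj_eq perm_inj).
Qed.

(** Vertices are the minimal faces above the least one: the vertex (0, b) below the
    image of (0, a) pulls back to a face below (0, a), which can only be
    (0, a) itself. *)
Lemma poset_aut_vertex f a : f \in poset_aut (graphicahedron E) ->
  exists b, f (face_of set0 a) = face_of set0 b.
Proof.
move=> fA; have f_le := poset_autP _ fA.
have [L LE [b fab]] := poset_aut_face set0 a fA; exists b.
have [M ME [c gbc]] := poset_aut_face set0 b (groupVr fA).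
have : (face_of M c <= face_of set0 a)%O.
  rewrite -f_le fab -gbc permKV face_of_le ?sub0set //=.
  by rewrite mulgV group1.
rewrite face_of_le ?sub0set // subset0 => /andP[/eqP M0 ca]; subst M.
by rewrite -(face_of_eq _ ca) ?sub0set // -gbc permKV.
Qed.

Definition vertices_below x : {set 'S_p} := [set a | (face_of set0 a <= x)%O].

Lemma card_vertices_below K a : K \subset E ->
  #|vertices_below (face_of K a)| = #|transp_group K|.
Proof.
move=> KE; rewrite -(card_rcoset (transp_group K) a); apply: eq_card => b.
by rewrite inE face_of_le ?sub0set //= mem_rcoset.
Qed.

Lemma poset_aut_card_vertices f x : f \in poset_aut (graphicahedron E) ->
  #|vertices_below (f x)| = #|vertices_below x|.
Proof.
have le g y : g \in poset_aut (graphicahedron E) ->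
    #|vertices_below y| <= #|vertices_below (g y)|.
  move=> gA; rewrite -!(card_imset _ face_of_vertex_inj).
  rewrite -(card_imset _ (@perm_inj _ g)).
  apply/subset_leq_card/subsetP => _ /imsetP[_ /imsetP[a ay ->] ->].
  have [b gab] := poset_aut_vertex a gA; apply/imsetP; exists b => //.
  by move: ay; rewrite /vertices_below !inE -gab (poset_autP _ gA).
move=> fA; apply/eqP; rewrite eqn_leq (le f) // andbT.
by rewrite -{2}[x](permK f) (le f^-1) ?groupV.
Qed.

(** The faces above the vertex (0, a) are exactly the (M, a), because the
    coset T_M c contains a iff it equals T_M a.  So f induces an embedding of
    the powerset of E, and the orders of the groups are numbers of vertices. *)
Lemma poset_aut_edge_map f a : f \in poset_aut (graphicahedron E) ->
  exists phi b,
    [/\ {in E, forall e, phi e \in E}, {in E &, injective phi},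
        forall M, M \subset E -> #|transp_group (phi @: M)| = #|transp_group M|
      & forall M, M \subset E -> f (face_of M a) = face_of (phi @: M) b].
Proof.
move=> fA; have f_le := poset_autP _ fA.
have [b fab] := poset_aut_vertex a fA.
have upper M : M \subset E ->
    exists2 N : {set {set 'I_p}}, N \subset E & f (face_of M a) = face_of N b.
  move=> ME; have [N NE [c fMc]] := poset_aut_face M a fA; exists N => //.
  rewrite fMc -(face_of_eq (a := b)) //.
  have : (f (face_of set0 a) <= f (face_of M a))%O.
    by rewrite f_le face_of_le ?sub0set //= mulgV group1.
  by rewrite fab fMc face_of_le ?sub0set.
pose Phi M := odflt set0 [pick N : {set {set 'I_p}} |
  (N \subset E) && (f (face_of M a) == face_of N b)].
have PhiP M : M \subset E -> Phi M \subset E /\ f (face_of M a) = face_of (Phi M) b.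
  move=> ME; rewrite /Phi; case: pickP => [N /andP[NE /eqP] //|none].
  by have [N NE fMN] := upper M ME; have := none N; rewrite NE fMN eqxx.
have [|M N|phi [phiE phi_inj phi_im]] := @powerset_embedding _ E Phi.
- by move=> M /PhiP[].
- rewrite !inE => /[dup] ME /PhiP[PME fM] /[dup] NE /PhiP[PNE fN].
  have := f_le (face_of M a) (face_of N a); rewrite fM fN !face_of_le //.
  by rewrite !mulgV !group1 !andbT.
have f_phi M : M \subset E -> f (face_of M a) = face_of (phi @: M) b.
  by move=> ME; rewrite -phi_im //; have [] := PhiP M ME.
exists phi, b; split=> // M ME.
rewrite -(card_vertices_below a ME) -(poset_aut_card_vertices _ fA) f_phi //.
by rewrite card_vertices_below // -phi_im //; have [] := PhiP M ME.
Qed.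

Lemma poset_aut_rank f j x : f \in poset_aut (graphicahedron E) ->
  x \in rank_faces E j -> f x \in rank_faces E j.
Proof.
move=> fA xj; have [|K KE [a def_x]] := @face_ofP x.
  by case: x xj; rewrite // inE.
have [phi [b [phiE phi_inj _ f_phi]]] := poset_aut_edge_map a fA.
move: xj; rewrite def_x f_phi // !face_edges_face_of //.
  by rewrite card_in_imset //; apply: sub_in2 (subsetP KE) _ phi_inj.
by apply/subsetP => _ /imsetP[e eK ->]; apply/phiE/(subsetP KE).
Qed.

Lemma graph_aut_imset k K : k \in graph_aut E -> simple_graph E -> K \subset E ->
  [set k @: (e : {set 'I_p}) | e in K] \subset E.
Proof.
rewrite inE => /'forall_'forall_eqP kE simpleE /subsetP KE.
apply/subsetP => _ /imsetP[e eK ->]; have eE := KE e eK.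
have /eqP/cards2P[u [v [_ def_e]]] := simpleE e eE.
have := kE u v; rewrite /adjacent -def_e eE.
by rewrite def_e imsetU !imset_set1.
Qed.

(** Conjugation by k carries T_K to T_{k(K)}, whence k acts on faces; the
    right translation by c takes care of transitivity on the cosets. *)
Lemma graph_aut_poset_aut k c : k \in graph_aut E -> simple_graph E ->
  exists2 f, f \in poset_aut (graphicahedron E) &
    forall K a, K \subset E ->
      f (face_of K a) = face_of [set k @: (e : {set 'I_p}) | e in K] (a ^ k * c).
Proof.
move=> kE simpleE; pose kk K := [set k @: (e : {set 'I_p}) | e in K].
pose g x := if x is Some F then
  face_of (kk (face_edges F)) (face_perm F ^ k * c) else None.
have kkE K : K \subset E -> kk K \subset E by apply: graph_aut_imset.
have kk_le K L a b : K \subset E -> L \subset E ->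
    (face_of (kk K) (a ^ k * c) <= face_of (kk L) (b ^ k * c))%O
      = (face_of K a <= face_of L b)%O.
  move=> KE LE; rewrite !face_of_le ?kkE //; congr (_ && _).
    apply/idP/idP => [/subsetP sKL|]; last exact: imsetS.
    apply/subsetP => e.
    by rewrite -(mem_imset_perm k K) -(mem_imset_perm k L); apply: sKL.
  rewrite transp_groupJ mem_conjg invMg mulgA mulgK -conjVg -conjMg.
  by rewrite -conjgM mulgV conjg1.
(* g is defined on representatives; the order relation [kk_le] shows that
   the choice of a coset representative is immaterial *)
have g_face K a : K \subset E -> g (face_of K a) = face_of (kk K) (a ^ k * c).
  move=> KE; case def_F: (face_of K a) => [F|] //; have FE := face_edges_sub F.
  rewrite /g; apply/eqP.
  rewrite Order.POrderTheory.eq_le !kk_le // -face_of_repr -def_F.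
  by rewrite Order.POrderTheory.le_refl.
have g_le : {mono g : x y / (x <= y)%O}.
  move=> [F|] [H|] //.
  by rewrite !face_of_repr !g_face ?face_edges_sub // kk_le ?face_edges_sub.
have g_inj : injective g by apply: Order.POrderTheory.inc_inj.
exists (perm g_inj) => [|K a KE]; last by rewrite permE g_face.
by apply/poset_autP => x y; rewrite !permE g_le.
Qed.
End Faces.

Theorem lemma2 (p : nat) (E : {set {set 'I_p}})
    (simpleE : simple_graph E) (connE : connected_graph E)
    (j : nat) (hj : 1 <= j <= #|E|) :
  face_transitive E j <-> subgraph_transitive E j.
Proof.
split=> [trans K L KE LE /eqP Kj /eqP Lj | trans].
  have [] := atransP2 trans (x := face_of E K 1) (y := face_of E L 1).
  - by rewrite face_edges_face_of.
  - by rewrite face_edges_face_of.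
  move=> f fA /= /esym; rewrite /aperm => fKL.
  have [phi [b [phiE phi_inj phi_card f_phi]]] := poset_aut_edge_map 1 fA.
  have [k kA k_phi] := edge_map_induced simpleE connE phiE phi_inj phi_card.
  have phiK : [set k @: (e : {set 'I_p}) | e in K] = phi @: K.
    by apply: eq_in_imset => e /(subsetP KE); apply: k_phi.
  exists k => //; apply: (@face_of_inj p E _ _ b 1) => //.
    exact: graph_aut_imset.
  by rewrite phiK -f_phi.
have [K [KE Kj]] : exists K : {set {set 'I_p}}, K \subset E /\ #|K| = j.
  have /andP[_ jE] := hj; exists [set x in take j (enum E)]; split.
    by apply/subsetP => e; rewrite inE => /mem_take; rewrite mem_enum.
  by rewrite cardsE (card_uniqP (take_uniq _ (enum_uniq _))) size_takel // -cardE.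
have xj : face_of E K 1 \in rank_faces E j by rewrite face_edges_face_of ?Kj.
apply/imsetP; exists (face_of E K 1) => //; apply/setP => y.
apply/idP/orbitP => [yj | [f fA <-]]; last exact: poset_aut_rank.
have [|L LE [b def_y]] := @face_ofP p E y; first by case: y yj; rewrite // inE.
have [k kA kKL] : exists2 k : 'S_p, k \in graph_aut E &
    [set k @: (e : {set 'I_p}) | e in K] = L.
  by apply: trans => //; apply/eqP; rewrite -(face_edges_face_of j b LE) -def_y.
have [f fA f_face] := graph_aut_poset_aut b kA simpleE.
by exists f; rewrite //= /aperm f_face // kKL conj1g mul1g.
Qed.
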